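(* Let $(X,d_X,\mu_X)$ be a metric measure space with $\mu_X(X)=1$, let $0<\varepsilon\le 1/2$ and $0<\kappa<1$. Assume that for some $\rho>0$ one has $1<\mathrm{Exp}_{\mathrm{Ledoux}}(X;1-\varepsilon,\rho)<\infty$. Then $$\mathrm{Exp}_{\mathrm{Gromov}}(X;\varepsilon,\rho)\ \ge\ \frac{\kappa\,\exp\!\left(\frac{\mathrm{ObsDiam}(X;-\kappa)\,\ln \mathrm{Exp}_{\mathrm{Ledoux}}(X;1-\varepsilon,\rho)}{2\rho}\right)}{2(1-\varepsilon)\left(\mathrm{Exp}_{\mathrm{Ledoux}}(X;1-\varepsilon,\rho)\right)^2}.$$
   Context: A metric measure space $(X,d_X,\mu_X)$ is a metric space $(X,d_X)$ with a finite Borel measure $\mu_X$; throughout $\mu_X(X)=1$. For $A\subset X$ and $r\ge 0$, $A_r=\{x\in X: d_X(x,A)\le r\}$. Gromov's expansion coefficient ($0<\varepsilon<1$, $\rho>0$): $\mathrm{Exp}_{\mathrm{Gromov}}(X;\varepsilon,\rho)$ is the supremum of all real $e\ge 1$ such that $\mu_X(A_\rho)\ge e\,\varepsilon$ for every Borel set $A\subset X$ with $\mu_X(A)\ge\varepsilon$. Ledoux's expansion coefficient ($0<\varepsilon<1$, $\rho>0$): $\mathrm{Exp}_{\mathrm{Ledoux}}(X;\varepsilon,\rho)$ is the supremum of all real $e\ge1$ such that $\mu_X(B_\rho)\ge e\,\mu_X(B)$ for every Borel set $B\subset X$ with $\mu_X(B_\rho)\le\varepsilon$. Observable diameter: for a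 Borel probability measure $\nu$ on $\mathbb{R}$ and $\kappa>0$, $\mathrm{PartDiam}_\nu(\mathbb{R};1-\kappa)$ is the infimum of all $D$ such that there is a (Borel) subset $A\subset\mathbb{R}$ with $\mathrm{diam}(A)\le D$ and $\nu(A)\ge 1-\kappa$. Then $\mathrm{ObsDiam}(X;-\kappa)$ is the supremum of $\mathrm{PartDiam}_{f_*\mu_X}(\mathbb{R};1-\kappa)$ over all $1$-Lipschitz functions $f:X\to\mathbb{R}$ (i.e. $|f(x)-f(y)|\le d_X(x,y)$), where $f_*\mu_X$ is the push-forward measure. *)

(* Defs.v *)
From HB Require Import structures.
From mathcomp Require Import all_boot all_order all_algebra.
From mathcomp Require Import all_classical all_reals all_analysis.

Set Implicit Arguments.
Unset Strict Implicit.
Unset Printing Implicit Defensive.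

Import Order.TTheory GRing.Theory Num.Theory.
Import numFieldNormedType.Exports.

Local Open Scope classical_set_scope.
Local Open Scope ring_scope.

(* The generated sigma-algebra type [g_sigma_algebraType] requires a pointed
   carrier, so metric spaces are taken with a distinguished point; this is no
   restriction for a space of total mass 1, which is nonempty. *)
#[short(type="pmetricType")]
HB.structure Definition PMetric (K : numDomainType) :=
  {M of Pointed M & Metric K M}.

Notation borelType X := (g_sigma_algebraType (@open X)).

Section metric_measure.
Context {R : realType} {X : pmetricType R}.
Implicit Types (A B : set X) (eps rho kappa : R).

(* Extended-real valued: the distance to the empty set is +oo. *)
Definition dist_to_set (x : X) A : \bar R :=
  ereal_inf [set (mdist x a)%:E | a in A].

Definition enlargement A (r : R) : set X :=
  [set x | (dist_to_set x A <= r%:E)%E].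

Definition exp_gromov (mu : probability (borelType X) R) eps rho : \bar R :=
  ereal_sup [set e%:E | e in [set e : R | 1 <= e /\
    forall A : set (borelType X), measurable A -> (eps%:E <= mu A)%E ->
      ((e * eps)%:E <= mu (enlargement A rho))%E]].

Definition exp_ledoux (mu : probability (borelType X) R) eps rho : \bar R :=
  ereal_sup [set e%:E | e in [set e : R | 1 <= e /\
    forall B : set (borelType X), measurable B ->
      (mu (enlargement B rho) <= eps%:E)%E ->
      (e%:E * mu B <= mu (enlargement B rho))%E]].

(* The empty set has diameter 0. *)
Definition diam (A : set R) : \bar R :=
  maxe 0%E (ereal_sup [set `|x - y|%:E | x in A & y in A]).

(* [part_diam nu m] is PartDiam_nu(R; m); here m = 1 - kappa. *)
Definition part_diam (nu : set R -> \bar R) (m : R) : \bar R :=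
  ereal_inf [set D%:E | D in [set D : R | exists A : set R,
    [/\ measurable A, (diam A <= D%:E)%E & (m%:E <= nu A)%E]]].

(* [obs_diam mu kappa] is ObsDiam(X; -kappa). Every 1-Lipschitz f is Borel, so
   [pushforward mu f] is a probability on the Borel sets of R. *)
Definition obs_diam (mu : probability (borelType X) R) kappa : \bar R :=
  ereal_sup [set part_diam (pushforward mu f) (1 - kappa) | f in
    [set f : X -> R | forall x y, `|f x - f y| <= mdist x y]].

End metric_measure.

(* Main.v *)
Require Import Defs.
From mathcomp Require Import all_boot all_order all_algebra.
From mathcomp Require Import all_classical all_reals all_analysis.
From mathcomp Require Import measurable_realfun ring lra.

Import Order.TTheory GRing.Theory Num.Theory.
Import numFieldNormedType.Exports.

Local Open Scope classical_set_scope.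
Local Open Scope ring_scope.

(** The right-hand side needs no estimate beyond [1 <= exp_gromov]: the left-hand
    side is at most [1].  Put [c = 1 - eps] and let [E] be the Ledoux coefficient
    at [c].  What has to be shown is the upper bound
      [obs_diam mu kappa <= 2 * rho * ln (2 * c * E ^+ 2 / kappa) / ln E],
    which is Ledoux expansion turned into exponential concentration of Lipschitz
    functions around their medians.

    Let [f] be 1-Lipschitz with median [m].  The set where [f - m] is positive has
    measure at most [1 / 2 <= c].  The superlevel set of [f - m] at height [s + rho]
    has its [rho]-enlargement inside the superlevel set at height [s]
    ([enlargement_superlevel]), so as long as [s > 0] Ledoux expansion applies and
    the measure drops by a factor [E] for each step of length [rho]; after [k]
    steps it is at most [c / E ^+ k] ([ledoux_tail]).  The same holds for [m - f].
    Hence, for [t > k * rho], the interval of radius [t] around [m] carries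
    [f]-mass at least [1 - 2 * c / E ^+ k], and the partial diameter is at most
    [2 * t] as soon as [2 * c <= kappa * E ^+ k] ([part_diam_le]).  Choosing [k]
    by rounding gives the bound ([obs_diam_le]). *)

(** * Enlargements and Lipschitz functions *)

Section enlargement.
Context {R : realType} {X : pmetricType R}.
Implicit Types (A : set X) (r : R).

(** Turns the infimum distance into approximating points, the form in which
    Lipschitz estimates apply; for empty [A] both sides fail. *)
Lemma enlargementP A r (x : X) :
  enlargement A r x <-> forall d, 0 < d -> exists2 a, A a & mdist x a < r + d.
Proof.
split=> [xA d d0|H].
- have : (dist_to_set x A < (r + d)%:E)%E.
    by rewrite (le_lt_trans xA)// lte_fin ltrDl.
  by move=> /ereal_inf_lt[_ [a Aa <-]]; rewrite lte_fin => xa; exists a.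
- apply/lee_addgt0Pr => d /H[a Aa xa].
  apply: ge_ereal_inf; exists (mdist x a)%:E; first by exists a.
  by rewrite -EFinD lee_fin ltW.
Qed.

Lemma subset_enlargement A r : 0 <= r -> A `<=` enlargement A r.
Proof.
move=> r0 x Ax; apply/enlargementP => d d0; exists x => //.
by rewrite mdistxx ltr_wpDl.
Qed.

(** The closed enlargement is a countable intersection of open ones, each a
    union of balls, hence Borel for arbitrary [A]. *)
Lemma measurable_enlargement A r :
  measurable (enlargement A r : set (borelType X)).
Proof.
rewrite (_ : enlargement A r =
    \bigcap_n \bigcup_(a in A) ball a (r + n.+1%:R^-1)).
  apply: bigcapT_measurable => n; apply: sub_sigma_algebra.
  apply: bigcup_open => a _.
  rewrite ballEmdist openE => x /= xa; apply/nbhs_ballP.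
  exists (r + n.+1%:R^-1 - mdist a x) => /=; first by rewrite subr_gt0.
  move=> y; rewrite ballEmdist /= => xy.
  by rewrite (le_lt_trans (metric_triangle _ x _))// -ltrBrDl.
apply/seteqP; split=> x.
- move=> /enlargementP H n _; have [|a Aa xa] := H n.+1%:R^-1; first by [].
  by exists a => //; rewrite ballEmdist /= metric_sym.
- move=> H; apply/enlargementP => d d0.
  have [N _ /(_ N (leqnn _)) Nd] := near_infty_natSinv_lt (PosNum d0).
  have [a Aa] := H N I; rewrite ballEmdist /= metric_sym => xa.
  by exists a => //; rewrite (lt_trans xa)// ltrD2l.
Qed.

End enlargement.

Section lipschitz.
Context {R : realType} {X : pmetricType R}.

(** By continuity the preimages of open intervals are open, and open intervals
    generate the Borel sets of [R]. *)
Lemma measurable_lipschitz (f : X -> R) :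
  (forall x y, `|f x - f y| <= mdist x y) ->
  measurable_fun setT (f : borelType X -> R).
Proof.
move=> f1.
apply: (measurability _ (RGenOpens.measurableE R)).
move=> _ [_ [a [b ->]] <-]; rewrite setTI; apply: sub_sigma_algebra => /=.
have cf : continuous f.
  move=> x; apply/cvgrPdist_lt => e e0; apply/nbhs_ballP.
  exists e => //= y; rewrite ballEmdist /= => xy.
  exact: le_lt_trans (f1 _ _) xy.
by apply: open_comp (interval_open _ _) => // x _; exact: cf.
Qed.

Lemma enlargement_superlevel (h : X -> R) (r s : R) :
  (forall x y, `|h x - h y| <= mdist x y) ->
  enlargement [set x | s + r <= h x] r `<=` [set x | s <= h x].
Proof.
move=> h1 x /enlargementP H /=; apply/ler_addgt0Pr => d /H[a /= ha xa].
have := ler_norm (h a - h x); rewrite distrC => /le_trans/(_ (h1 _ _)).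
lra.
Qed.

End lipschitz.

(** * Level sets and medians of random variables *)

Lemma measurable_superlevel {d} {T : measurableType d} {R : realType}
    (h : T -> R) (s : R) :
  measurable_fun setT h -> measurable [set x | s <= h x].
Proof.
by move=> mh; rewrite -preimage_itvcy -[X in measurable X]setTI; exact: mh.
Qed.

Lemma measurable_sublevel {d} {T : measurableType d} {R : realType}
    (h : T -> R) (s : R) :
  measurable_fun setT h -> measurable [set x | h x <= s].
Proof.
by move=> mh; rewrite -preimage_itvNyc -[X in measurable X]setTI; exact: mh.
Qed.

(** Allowing an error [eta] on both sides, the supremum of the points where the
    distribution function is below one half serves without any discussion of
    one-sided continuity. *)
Lemma approx_median {d} {T : measurableType d} {R : realType}
    (P : probability T R) (Y : {RV P >-> R}) (eta : R) : 0 < eta ->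
  exists m : R, ((2^-1)%:E <= P [set t | Y t <= m + eta]%R)%E /\
                ((2^-1)%:E <= P [set t | m - eta <= Y t]%R)%E.
Proof.
move=> eta0.
have cdfE r : cdf Y r = P [set t | Y t <= r] by rewrite -preimage_itvNyc.
have mY r : measurable [set t | Y t <= r] by exact: measurable_sublevel.
pose M := [set r | (cdf Y r < (2^-1)%:E)%E].
have M0 : M !=set0.
  have /fine_cvgP[cfin c0] := cvg_cdfNy0 Y.
  have := cvgr_lt _ c0 2^-1; rewrite invr_gt0 ltr0n => /(_ _ isT) cl.
  have [r [rfin rl]] := filter_ex (filterI cfin cl).
  by exists r; rewrite /M /= -(fineK rfin) lte_fin.
have ubM : has_ubound M.
  have /fine_cvgP[cfin c1] := cvg_cdfy1 Y.
  have := cvgr_gt _ c1 2^-1; rewrite invf_lt1 ?ltr1n// => /(_ _ isT) cg.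
  have [r [rfin rg]] := filter_ex (filterI cfin cg).
  exists r => x Mx; rewrite leNgt; apply/negP => /ltW rx.
  have := le_lt_trans (cdf_nondecreasing Y rx) Mx.
  by rewrite -(fineK rfin) lte_fin ltNge (ltW rg).
exists (sup M); split.
- rewrite -cdfE leNgt; apply/negP => Mr.
  have := ub_le_sup ubM Mr.
  by rewrite leNgt ltrDl eta0.
- have [r Mr mr] := sup_adherent eta0 (conj M0 ubM).
  apply: (@le_trans _ _ (P (~` [set t | Y t <= r]))).
    rewrite probability_setC// -cdfE.
    have -> : (2^-1)%:E = (1 - (2^-1)%:E)%E :> \bar R.
      by rewrite -EFinB; congr EFin; lra.
    by apply: leeB => //; exact: ltW.
  rewrite le_measure ?inE//; first exact: measurableC.
    exact: measurable_superlevel.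
  by move=> t /= /negP; rewrite -ltNge => /(lt_trans mr)/ltW.
Qed.

(** * Concentration from Ledoux expansion *)

Section tail.
Context {R : realType} {X : pmetricType R} (mu : probability (borelType X) R).

Definition ledoux_expands (c rho e : R) :=
  forall B : set (borelType X), measurable B ->
    (mu (enlargement B rho) <= c%:E)%E ->
    (e%:E * mu B <= mu (enlargement B rho))%E.

(** The superlevel sets of a Lipschitz function, cut at heights spaced by
    [rho], are nested so that the [rho]-enlargement of each lies in the
    previous one; each step therefore divides the measure by [e].  The
    hypothesis on the sublevel set at [0] bounds the first measure by [c], and
    this is what allows the expansion property to be applied at every step. *)
Lemma ledoux_tail (c e rho delta : R) (h : X -> R) :
  0 <= e -> 0 <= rho -> 0 < delta ->
  ledoux_expands c rho e ->
  (forall x y, `|h x - h y| <= mdist x y) ->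
  ((1 - c)%:E <= mu [set x | h x <= 0]%R)%E ->
  forall k, ((e ^+ k)%:E * mu [set x | delta + k%:R * rho <= h x]%R <= c%:E)%E.
Proof.
move=> e0 rho0 d0 He h1 hmed.
have mh := measurable_lipschitz h h1.
have mge s : measurable ([set x | s <= h x] : set (borelType X)).
  exact: measurable_superlevel.
have mle s : measurable ([set x | h x <= s] : set (borelType X)).
  exact: measurable_sublevel.
set S := fun k : nat => [set x | delta + k%:R * rho <= h x].
have S0 : (mu (S 0%N) <= c%:E)%E.
  apply: (@le_trans _ _ (mu (~` [set x | h x <= 0]))).
    rewrite le_measure ?inE//; first exact: mge.
    - exact: measurableC.
    - by move=> x; rewrite /S /= mul0r addr0 => dx /(le_trans dx); lra.
  rewrite probability_setC//.
  have -> : c%:E = (1 - (1 - c)%:E)%E by rewrite -EFinB; congr EFin; lra.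
  exact: leeB.
have Sc k : (mu (S k) <= c%:E)%E.
  apply: le_trans S0; rewrite le_measure ?inE//; [exact: mge|exact: mge|].
  move=> x; rewrite /S /=; apply: le_trans; rewrite mul0r addr0 lerDl.
  by rewrite mulr_ge0.
have sub k : enlargement (S k.+1) rho `<=` S k.
  rewrite /S (_ : delta + k.+1%:R * rho = delta + k%:R * rho + rho); last first.
    by rewrite -[in LHS]natr1; lra.
  exact: enlargement_superlevel.
elim=> [|k IH]; first by rewrite expr0 mul1e.
have muE : (mu (enlargement (S k.+1) rho) <= mu (S k))%E.
  rewrite le_measure ?inE//; last exact: mge.
  exact: measurable_enlargement.
apply: le_trans IH; rewrite exprSr EFinM -muleA; apply: lee_wpmul2l.
  by rewrite lee_fin exprn_ge0.
apply: (le_trans _ muE); apply: He; first exact: mge.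
exact: le_trans muE (Sc k).
Qed.

Lemma exp_ledoux_fin_num (c rho : R) :
  (1 < exp_ledoux mu c rho < +oo)%E -> exp_ledoux mu c rho \is a fin_num.
Proof.
by move=> /andP[E1 Eoo]; rewrite ge0_fin_numE// (le_trans _ (ltW E1)).
Qed.

Lemma fine_exp_ledoux_gt1 (c rho : R) :
  (1 < exp_ledoux mu c rho < +oo)%E -> 1 < fine (exp_ledoux mu c rho).
Proof.
move=> E1oo; rewrite -lte_fin fineK ?exp_ledoux_fin_num//.
by case/andP: E1oo.
Qed.

(** The supremum defining the coefficient is itself admissible: for each [B]
    of positive measure every admissible factor is at most
    [mu (enlargement B rho) / mu B]. *)
Lemma exp_ledoux_attained (c rho : R) :
  (1 < exp_ledoux mu c rho < +oo)%E ->
  ledoux_expands c rho (fine (exp_ledoux mu c rho)).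
Proof.
move=> E1oo B mB Bc; rewrite fineK ?exp_ledoux_fin_num//.
have Bf : mu B \is a fin_num by exact: fin_num_measure.
have Bef : mu (enlargement B rho) \is a fin_num.
  by apply: fin_num_measure; exact: measurable_enlargement.
have [->|B0] := eqVneq (mu B) 0%E; first by rewrite mule0.
have {}B0 : (0 < fine (mu B)) by rewrite fine_gt0// lt0e B0 measure_ge0 ltey_eq Bf.
rewrite -(fineK Bf) -(fineK Bef) -lee_pdivlMr//.
apply: ge_ereal_sup => _ [e [e1 He] <-].
rewrite lee_pdivlMr// (fineK Bf) (fineK Bef).
exact: He.
Qed.

(** Around an approximate median [m] the interval of radius [t] misses only two
    tails of [f], the tails of [f - m] and of [m - f], each of measure at most
    [c / e ^+ k <= kappa / 2]. *)
Lemma part_diam_le (c e rho t kappa : R) (k : nat) (f : X -> R) :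
  1 / 2 <= c -> 0 < e -> 0 <= rho -> k%:R * rho < t ->
  2 * c <= kappa * e ^+ k ->
  ledoux_expands c rho e ->
  (forall x y, `|f x - f y| <= mdist x y) ->
  (part_diam (pushforward mu f) (1 - kappa) <= (2 * t)%:E)%E.
Proof.
move=> c2 e0 rho0 kt ck He f1.
have mf := measurable_lipschitz f f1.
(* [t = k * rho + 2 * d]: one [d] pays for the approximate median, the other is
   the positive height at which the first superlevel set is cut. *)
pose d := (t - k%:R * rho) / 2.
have d0 : 0 < d by rewrite /d; lra.
have krho : 0 <= k%:R * rho by rewrite mulr_ge0.
pose Y : {RV mu >-> R} := mfun_Sub (mem_set mf).
have [m [m1 m2]] := approx_median mu Y d d0.
have half : ((1 - c)%:E <= (2^-1 : R)%:E)%E by rewrite lee_fin; lra.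
have tail h : (forall x y, `|h x - h y| <= mdist x y) ->
    ((2^-1)%:E <= mu [set x | h x <= 0]%R)%E ->
    (mu [set x | d + k%:R * rho <= h x]%R <= (kappa / 2)%:E)%E.
  move=> h1 /(le_trans half)/(ledoux_tail c e rho d h (ltW e0) rho0 d0 He h1)/(_ k).
  rewrite muleC -lee_pdivlMr ?exprn_gt0// => /le_trans; apply.
  rewrite -EFinM lee_fin ler_pdivrMr ?exprn_gt0//; lra.
have up : (mu [set x | m + t <= f x]%R <= (kappa / 2)%:E)%E.
  have := tail (fun x => f x - (m + d)).
  rewrite (_ : [set x | f x - (m + d) <= 0] = [set x | f x <= m + d]); last first.
    by apply/seteqP; split=> x /=; lra.
  rewrite (_ : [set x | d + _ <= _] = [set x | m + t <= f x]); last first.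
    by apply/seteqP; split=> x /=; rewrite /d; lra.
  apply=> // x y; rewrite (_ : _ - _ = f x - f y)//; lra.
have lo : (mu [set x | f x <= m - t]%R <= (kappa / 2)%:E)%E.
  have := tail (fun x => (m - d) - f x).
  rewrite (_ : [set x | m - d - f x <= 0] = [set x | m - d <= f x]); last first.
    by apply/seteqP; split=> x /=; lra.
  rewrite (_ : [set x | d + _ <= _] = [set x | f x <= m - t]); last first.
    by apply/seteqP; split=> x /=; rewrite /d; lra.
  apply=> // x y; rewrite (_ : _ - _ = f y - f x); first by rewrite distrC.
  lra.
have mup : measurable ([set x | m + t <= f x] : set (borelType X)).
  exact: measurable_superlevel.
have mlo : measurable ([set x | f x <= m - t] : set (borelType X)).
  exact: measurable_sublevel.
apply: ge_ereal_inf; exists (2 * t)%:E => //; exists (2 * t) => //.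
exists `](m - t), (m + t)[%classic; split.
- exact: measurable_itv.
- rewrite /diam ge_max lee_fin; apply/andP; split; first lra.
  apply: ge_ereal_sup => _ [x + [y + <-]]; rewrite /= !in_itv /= lee_fin.
  move=> /andP[? ?] /andP[? ?]; rewrite ler_norml; lra.
- rewrite /pushforward (_ : _ @^-1` _ =
      ~` ([set x | m + t <= f x] `|` [set x | f x <= m - t])); last first.
    apply/seteqP; split=> x /=; rewrite in_itv /=.
      by move=> /andP[? ?] []; lra.
    move=> /not_orP[/negP + /negP]; rewrite -!ltNge => -> ->//.
  rewrite probability_setC; last exact: measurableU.
  rewrite EFinB; apply: leeB => //.
  apply: (le_trans (measureU2 _ mup mlo)).
  apply: (le_trans (leeD up lo)); rewrite -EFinD lee_fin; lra.
Qed.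

(** The factor [1] is admissible because [A] lies in its enlargement. *)
Lemma exp_gromov_ge1 (eps rho : R) : 0 <= rho -> (1 <= exp_gromov mu eps rho)%E.
Proof.
move=> rho0; apply: ereal_sup_ubound; exists 1 => //; split=> // A mA epsA.
rewrite mul1r (le_trans epsA)// le_measure ?inE//.
  exact: measurable_enlargement.
exact: subset_enlargement.
Qed.

(** The radius [rho * s] with [E `^ s = 2 * c * E ^+ 2 / kappa] leaves room for
    [k > s - 2] full steps of length [rho], after which both tails together have
    measure at most [2 * c / E ^+ k <= kappa].  The factor [E ^+ 2] is the price
    of this rounding; it also makes [s] at least [2], so that such a [k] exists. *)
Lemma obs_diam_le (c rho kappa : R) (E := fine (exp_ledoux mu c rho)) :
  1 / 2 <= c -> 0 < kappa -> kappa < 1 -> 0 < rho ->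
  (1 < exp_ledoux mu c rho < +oo)%E ->
  (obs_diam mu kappa <= (2 * (rho * (ln (2 * c * E ^+ 2 / kappa) / ln E)))%:E)%E.
Proof.
move=> c2 kappa0 kappa1 rho0 E1oo.
have E1 : 1 < E by exact: fine_exp_ledoux_gt1.
have E0 : 0 < E by lra.
have lnE : 0 < ln E by exact: ln_gt0.
set s := _ / ln E.
have E2s : E ^+ 2 <= 2 * c * E ^+ 2 / kappa.
  rewrite ler_pdivlMr// mulrC ler_wpM2r ?exprn_ge0 ?ltW//; lra.
have q0 : 0 < 2 * c * E ^+ 2 / kappa by apply: lt_le_trans E2s; rewrite exprn_gt0.
have s2 : 2 <= s.
  rewrite /s ler_pdivlMr// (mulr_natl (ln E)) -lnXn// ler_ln ?posrE ?exprn_gt0//.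
have := truncn_itv (le_trans (ler0n R 2) s2).
(* [k] is one less than the integer part of [s], so that [k * rho < rho * s]
   strictly even when [s] is an integer. *)
case tE : (Num.truncn s) => [|k] /andP[ks sk].
  by have := le_lt_trans s2 sk; rewrite ltr_nat.
apply: ge_ereal_sup => _ [f f1 <-].
apply: (@part_diam_le c E rho _ kappa k) => //; first exact: ltW.
- rewrite mulrC ltr_pM2l//; apply: lt_le_trans ks; by rewrite ltr_nat.
- have : 2 * c * E ^+ 2 / kappa <= E ^+ k.+2.
    rewrite -ler_ln ?posrE ?exprn_gt0// lnXn// -[ln E *+ _]mulr_natl -ler_pdivrMr//.
    exact: ltW.
  rewrite ler_pdivrMr// -(addn2 k) exprD [_ * kappa]mulrC.
  by rewrite (mulrA kappa) ler_pM2r// exprn_gt0.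
- exact: exp_ledoux_attained.
Qed.

End tail.

Theorem theorem6p1 (R : realType) (X : pmetricType R)
    (mu : probability (borelType X) R) (eps kappa rho : R)
    (eps_gt0 : 0 < eps) (eps_le : eps <= 1 / 2)
    (kappa_gt0 : 0 < kappa) (kappa_lt1 : kappa < 1)
    (rho_gt0 : 0 < rho)
    (ledoux_gt1 : (1 < exp_ledoux mu (1 - eps) rho)%E)
    (ledoux_fin : (exp_ledoux mu (1 - eps) rho < +oo)%E) :
  let E : R := fine (exp_ledoux mu (1 - eps) rho) in
  (kappa%:E * expeR (obs_diam mu kappa * (ln E / (2 * rho))%:E)
     * (2 * (1 - eps) * E ^+ 2)^-1%:E
   <= exp_gromov mu eps rho)%E.
Proof.
set E : R := fine (exp_ledoux mu (1 - eps) rho); cbv zeta.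
(* The trivial bound on the right-hand side is enough. *)
apply: (le_trans _ (exp_gromov_ge1 mu eps rho (ltW rho_gt0))).
have E1oo : (1 < exp_ledoux mu (1 - eps) rho < +oo)%E.
  by rewrite ledoux_gt1 ledoux_fin.
have E1 : 1 < E by exact: fine_exp_ledoux_gt1.
have lnE : 0 < ln E by exact: ln_gt0.
have E20 : 0 < E ^+ 2 by rewrite exprn_gt0//; lra.
have q0 : 0 < 2 * (1 - eps) * E ^+ 2 by rewrite mulr_gt0//; lra.
have c2 : 1 / 2 <= 1 - eps by lra.
rewrite muleC; apply: (@le_trans _ _ ((2 * (1 - eps) * E ^+ 2)^-1%:E *
    (kappa%:E * (2 * (1 - eps) * E ^+ 2 / kappa)%:E))%E); last first.
  rewrite -!EFinM lee_fin [kappa * _]mulrC divfK ?gt_eqF// mulVf// gt_eqF//.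
apply: lee_wpmul2l; first by rewrite lee_fin invr_ge0 ltW.
apply: lee_wpmul2l; first by rewrite lee_fin ltW.
have slope0 : (0 <= (ln E / (2 * rho))%:E)%E.
  by rewrite lee_fin divr_ge0 ?mulr_ge0// ltW.
have := lee_wpmul2r slope0
  (obs_diam_le mu _ _ _ c2 kappa_gt0 kappa_lt1 rho_gt0 E1oo).
rewrite -lee_expeR => /le_trans; apply.
rewrite -EFinM /= lee_fin -/E.
rewrite [X in expR X](_ : _ = ln (2 * (1 - eps) * E ^+ 2 / kappa)); last first.
  by set L := ln (_ / kappa); field; rewrite !gt_eqF.
by rewrite lnK// posrE divr_gt0.
Qed.
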